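(* Let $C_n$ be a cycle with standard orientation and at least two distinct edge labels. The Lie algebra $\mathfrak{n}_{C_n}$ has a nontrivial abelian factor if and only if, for each edge label, the induced subgraph of $C_n$ on that edge label consists of a disjoint union of paths each with an even number of edges.
   Context: A directed edge-labeled graph $G=(V,E,C)$ is a finite connected directed graph with vertex set $V=\{v_1,\dots,v_n\}$ and edge set $E$, together with a surjective labeling $c:E\to C=\{Z_1,\dots,Z_p\}$ (labels may be repeated on different edges). An edge directed from $v$ to $w$ is written $(v,w)$. The Lie algebra $\mathfrak{n}_G$: as a real vector space $\mathfrak{n}_G=\mathfrak{v}\oplus\mathfrak{w}$, where $\mathfrak{v}$ has basis $V$ and $\mathfrak{w}$ has basis $C$. The bracket is bilinear and skew-symmetric with $[v_i,v_j]=\sum_{\ell}(\epsilon_\ell-\epsilon'_\ell)Z_\ell$, where $\epsilon_\ell=1$ if $c(v_i,v_j)=Z_\ell$ and $0$ otherwise, and $\epsilon'_\ell=1$ if $c(v_j,v_i)=Z_\ell$ and $0$ otherwise; all other brackets of basis elements are zero. For a simple graph the derived algebra is $[\mathfrak{n}_G,\mathfrak{n}_G]=\mathfrak{w}$. The abelian factor of $\mathfrak{n}_G$ is the unique subspace $\mathfrak{a}\subseteq\mathfrak{v}$ such that the center satisfies $\mathcal{Z}(\mathfrak{n}_G)=[\mathfrak{n}_G,\mathfrak{n}_G]\oplus\mathfrak{a}$; it is nontrivial if $\mathfrak{a}\ne\{0\}$. $C_n$ ($n\ge 3$) is the cycle with vertices $v_1,\dots,v_n$ and $n$ edges, $v_i$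 adjacent to $v_{i+1}$ for $1\le i\le n-1$ and $v_n$ adjacent to $v_1$. It has standard orientation if its edges are directed as $(v_i,v_{i+1})$ for $1\le i\le n-1$ and $(v_n,v_1)$. The induced subgraph on an edge label $Z$ is the subgraph formed by all edges with label $Z$ and their endpoints; the paths are its connected components (edge directions being disregarded). *)

(* Defs.v *)
From HB Require Import structures.
From mathcomp Require Import all_boot all_order all_algebra reals.

Set Implicit Arguments.
Unset Strict Implicit.
Unset Printing Implicit Defensive.

Import GRing.Theory.
Local Open Scope ring_scope.

HB.mixin Record Vector_isLie (R : fieldType) L of Vector R L := {
  lie : L -> L -> L;
  lie_linearl : forall y, linear (lie^~ y);
  lie_linearr : forall x, linear (lie x);
  liexx : forall x, lie x x = 0;
  lie_jacobi : forall x y z,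
    lie x (lie y z) + lie y (lie z x) + lie z (lie x y) = 0
}.

#[short(type="lieAlgType")]
HB.structure Definition LieAlgebra (R : fieldType) :=
  {L of Vector R L & Vector_isLie R L}.

Section LieTheory.
Variables (R : fieldType) (L : lieAlgType R).
Implicit Types (x y : L) (U : {vspace L}).

Definition lier y x := lie x y.

HB.instance Definition _ y := GRing.isLinear.Build R L L *:%R (lier y)
  (lie_linearl y).
HB.instance Definition _ x := GRing.isLinear.Build R L L *:%R (lie x)
  (lie_linearr x).

Definition center : {vspace L} :=
  (\bigcap_(y <- vbasis {:L}) lker (linfun (lier y)))%VS.

Definition derived : {vspace L} :=
  <<[seq lie x y | x <- vbasis {:L}, y <- vbasis {:L}]>>%VS.

Lemma centerP x : reflect (forall y, lie x y = 0) (x \in center).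
Proof.
apply: (iffP idP) => [xZ y | xZ]; last first.
  rewrite /center; elim/big_rec: _ => [|y U _ xU]; first exact: memvf.
  by rewrite memv_cap xU memv_ker lfunE /= /lier xZ eqxx.
have xb b : b \in (vbasis {:L} : seq L) -> lie x b = 0.
  move=> bL; move: xZ; rewrite /center (big_rem b) //= memv_cap.
  by case/andP=> + _; rewrite memv_ker lfunE /= /lier => /eqP.
rewrite (coord_vbasis (memvf y)) linear_sum big1 // => i _.
by rewrite linearZ /= xb ?scaler0 // mem_nth ?size_tuple.
Qed.

Lemma derivedP U : reflect (forall x y, lie x y \in U) (derived <= U)%VS.
Proof.
apply: (iffP span_subvP) => [bU x y | LU z]; last first.
  by case/allpairsP=> -[x y] [_ _ ->]; apply: LU.
rewrite (coord_vbasis (memvf y)) linear_sum rpred_sum //= => j _.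
rewrite linearZ rpredZ //= -/(lier _ x).
rewrite (coord_vbasis (memvf x)) linear_sum rpred_sum //= => i _.
rewrite linearZ rpredZ //=; apply: bU; apply: allpairs_f;
  by rewrite mem_nth ?size_tuple.
Qed.

End LieTheory.

(* [label v w = Some Z] means that (v, w) is an edge labelled Z, and
   [label v w = None] that (v, w) is not an edge. *)
Record elgraph (V C : finType) := ELGraph {
  label : V -> V -> option C;
  label_surj : forall Z, exists v w, label v w = Some Z;
  elgraph_connected : forall v w,
    connect [rel a b | isSome (label a b) || isSome (label b a)] v w
}.

Definition edge V C (G : elgraph V C) : rel V := [rel v w | isSome (label G v w)].

Definition graph_lie (R : fieldType) V C of elgraph V C : Type :=
  ({ffun V -> R^o} * {ffun C -> R^o})%type.

Section GraphLie.
Variables (R : fieldType) (V C : finType) (G : elgraph V C).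
Local Notation N := (graph_lie R G).

HB.instance Definition _ := Vector.copy N ({ffun V -> R^o} * {ffun C -> R^o})%type.

Definition vtx v : N := ([ffun u => (u == v)%:R], 0).
Definition lab Z : N := (0, [ffun Y => (Y == Z)%:R]).

Definition basis_bracket v w : N :=
  \sum_(Z : C) ((label G v w == Some Z)%:R - (label G w v == Some Z)%:R) *: lab Z.

Definition graph_bracket (x y : N) : N :=
  \sum_v \sum_w (x.1 v * y.1 w) *: basis_bracket v w.

Lemma basis_bracketC v w : basis_bracket v w = - basis_bracket w v.
Proof.
by rewrite /basis_bracket -sumrN; apply: eq_bigr => Z _; rewrite -scaleNr opprB.
Qed.

Lemma graph_bracketC x y : graph_bracket x y = - graph_bracket y x.
Proof.
rewrite /graph_bracket exchange_big -sumrN; apply: eq_bigr => w _ /=.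
rewrite -sumrN; apply: eq_bigr => v _ /=.
by rewrite basis_bracketC scalerN mulrC.
Qed.

Lemma graph_bracket_linearl y : linear (graph_bracket^~ y).
Proof.
move=> a x x'; rewrite /graph_bracket scaler_sumr -big_split.
apply: eq_bigr => v _ /=; rewrite scaler_sumr -big_split.
apply: eq_bigr => w _ /=.
by rewrite !ffunE mulrDl scalerDl scalerA -mulrA.
Qed.

Lemma graph_bracket_linearr x : linear (graph_bracket x).
Proof.
move=> a y y'; rewrite graph_bracketC graph_bracket_linearl opprD -scalerN.
by rewrite -!graph_bracketC.
Qed.

Lemma graph_bracketxx x : graph_bracket x x = 0.
Proof.
pose A v w : N := \sum_(Z : C) (label G v w == Some Z)%:R *: lab Z.
have AE v w : basis_bracket v w = A v w - A w v.
  by rewrite -sumrB; apply: eq_bigr => Z _; rewrite scalerBl.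
transitivity (\sum_v \sum_w (x.1 v * x.1 w) *: A v w -
              \sum_v \sum_w (x.1 v * x.1 w) *: A w v).
  rewrite -sumrB; apply: eq_bigr => v _; rewrite -sumrB.
  by apply: eq_bigr => w _; rewrite AE scalerBr.
apply/eqP; rewrite subr_eq0 exchange_big; apply/eqP.
by apply: eq_bigr => w _; apply: eq_bigr => v _; rewrite mulrC.
Qed.

Lemma graph_bracket1 x y : (graph_bracket x y).1 = 0.
Proof.
have fst_sum (I : finType) (F : I -> N) : (forall i, (F i).1 = 0) ->
    (\sum_i F i).1 = 0.
  move=> F0; elim/big_ind: _ => // a b a0 b0.
  by rewrite -[LHS]/(a.1 + b.1) a0 b0 addr0.
apply: (fst_sum) => v; apply: (fst_sum) => w.
rewrite /= fst_sum ?scaler0 // => Z; exact: scaler0.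
Qed.

Lemma graph_bracket0r x y : y.1 = 0 -> graph_bracket x y = 0.
Proof.
move=> y0; rewrite /graph_bracket big1 // => v _; rewrite big1 // => w _.
by rewrite y0 ffunE mulr0 scale0r.
Qed.

Lemma graph_bracket_jacobi x y z :
  graph_bracket x (graph_bracket y z) + graph_bracket y (graph_bracket z x)
    + graph_bracket z (graph_bracket x y) = 0.
Proof.
have E a b c : graph_bracket a (graph_bracket b c) = 0.
  exact/graph_bracket0r/graph_bracket1.
by rewrite !E !addr0.
Qed.

HB.instance Definition _ := Vector_isLie.Build R N
  graph_bracket_linearl graph_bracket_linearr
  graph_bracketxx graph_bracket_jacobi.

Lemma lie_vtx v w : lie (vtx v) (vtx w) = basis_bracket v w.
Proof.
rewrite /lie /= /graph_bracket (bigD1 v) //= (bigD1 w) //=.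
rewrite !ffunE !eqxx mulr1 scale1r !big1 ?addr0 // => [u uv | u uw].
  by rewrite big1 // => t _; rewrite !ffunE (negPf uv) mul0r scale0r.
by rewrite !ffunE (negPf uw) mulr0 scale0r.
Qed.

Lemma lie_lab x Z : lie x (lab Z) = 0.
Proof. exact: graph_bracket0r. Qed.

Definition vpart : {vspace N} := <<[seq vtx v | v : V]>>%VS.

Lemma memv_vpart x : (x \in vpart) = (x.2 == 0).
Proof.
apply/idP/eqP => [xV | x20].
  have /subvP/(_ x xV) : (vpart <= lker (linfun (snd : N -> {ffun C -> R^o})))%VS.
    apply/span_subvP => _ /mapP[v _ ->].
    by rewrite memv_ker lfunE.
  by rewrite memv_ker lfunE => /eqP.
have -> : x = \sum_v x.1 v *: vtx v.
  rewrite [LHS]surjective_pairing x20 [RHS]surjective_pairing.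
  congr (_, _); last first.
    by rewrite linear_sum big1 // => v _; rewrite /= scaler0.
  rewrite linear_sum; apply/ffunP => u; rewrite sum_ffunE (bigD1 u) //=.
  rewrite big1 ?addr0 => [|v vu]; first by rewrite !ffunE eqxx [RHS]mulr1.
  by rewrite !ffunE eq_sym (negPf vu) [LHS]mulr0.
rewrite rpred_sum // => v _; rewrite rpredZ // memv_span //.
by apply: map_f; rewrite mem_enum.
Qed.

Definition is_abelian_factor (a : {vspace N}) : Prop :=
  [/\ (a <= vpart)%VS,
      center N = (derived N + a)%VS
    & directv (derived N + a)].

Lemma abelian_factor_uniq a b :
  is_abelian_factor a -> is_abelian_factor b -> a = b.
Proof.
suff E c : is_abelian_factor c -> c = (center N :&: vpart)%VS.
  by move=> /E-> /E->.
case=> cV cZ _; apply/eqP; rewrite eqEsubv subv_cap cV cZ addvSr /=.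
apply/subvP => x; rewrite memv_cap => /andP[/memv_addP[d dD [e ec ->]]].
rewrite memv_vpart /= => /eqP de0.
have d1 : d.1 = 0.
  have /subvP/(_ d dD) :
      (derived N <= lker (linfun (fst : N -> {ffun V -> R^o})))%VS.
    by apply/derivedP => y z; rewrite memv_ker lfunE; apply/eqP/graph_bracket1.
  by rewrite memv_ker lfunE => /eqP.
have e2 : e.2 = 0 by apply/eqP; rewrite -memv_vpart (subvP cV).
have -> : d = 0.
  rewrite [d]surjective_pairing d1; congr (_, _).
  by rewrite e2 addr0 in de0.
by rewrite add0r.
Qed.

Definition has_nontrivial_abelian_factor : Prop :=
  exists2 a, is_abelian_factor a & a != 0%VS.

End GraphLie.

Definition standard_cycle n C (G : elgraph 'I_n C) : Prop :=
  forall i j : 'I_n, edge G i j = (j == ordS i).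

Section LabelSubgraph.
Variables (V C : finType) (G : elgraph V C) (Z : C).

(* The induced subgraph on the label Z, edge directions being disregarded. *)
Definition label_adj : rel V :=
  [rel v w | (label G v w == Some Z) || (label G w v == Some Z)].

Definition label_verts : {set V} := [set v | [exists w, label_adj v w]].

Definition label_components : {set {set V}} :=
  [set [set w | connect label_adj v w] | v in label_verts].

End LabelSubgraph.

(* The subgraph induced by the relation [e] on [W] is the path with successive
   vertices [s], which has [(size s).-1] edges. *)
Definition is_path_graph (V : finType) (e : rel V) (W : {set V}) (s : seq V) :=
  [/\ uniq s, W =i s
    & {in W &, forall v w,
        e v w = (index w s == (index v s).+1) || (index v s == (index w s).+1)}].

Definition even_path_union V C (G : elgraph V C) (Z : C) : Prop :=
  forall W, W \in label_components G Z ->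
  exists2 s, is_path_graph (label_adj G Z) W s & ~~ odd (size s).-1.

(* Main.v *)
Require Import Defs.
From mathcomp Require Import all_boot all_order all_algebra reals.

(** Bracketing x in the span of the vertices with the vertex w gives
    x(w-1) c(w-1,w) - x(w+1) c(w,w+1), where c is the edge labelling and indices
    are modulo n.  Hence x is central iff, at every w, x(w-1) = x(w+1) when the
    two edges at w share their label, and x(w-1) = x(w+1) = 0 when they do not.
    Call w a break in the second case.  In both cases x(w-1) = x(w+1), so a
    central x is invariant under translation by two and vanishes next to every
    break ([center_cycleP]).

    As there are at least two labels, breaks exist and cut the cycle into
    maximal monochromatic runs, each going from one break to the next.  If a run
    has odd length, the vanishing next to its two ends propagates, by steps of
    two, to two adjacent vertices, so x = 0.  If all runs have even length, then n is even, all
    breaks have the same parity, and the indicator function of the vertices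
    of that parity is a nonzero central vector ([center_vpart_evenP]).

    On the graph side, the components of the subgraphs induced on the labels are
    exactly the vertex sets of the runs, and a run of length L is a path with L
    edges ([even_path_unionP]).  On the algebra side, each label of the cycle is
    the bracket of two vertices, so the derived algebra is the span of the
    labels, and the abelian factor is the set of central vectors in the span of
    the vertices ([nontrivial_abelian_factorP]). *)

Set Implicit Arguments.
Unset Strict Implicit.
Unset Printing Implicit Defensive.

(** * The abelian factor of a graph Lie algebra *)

Section Graph.
Import GRing.Theory.
Local Open Scope ring_scope.
Variables (R : fieldType) (V C : finType) (G : elgraph V C).
Local Notation N := (graph_lie R G).

Lemma lab_center (Z : C) : lab R G Z \in center N.
Proof.
by apply/centerP => y; rewrite [LHS]graph_bracketC [graph_bracket _ _]lie_lab oppr0.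
Qed.

(** Without an antiparallel edge, [v, w] is the single basis vector Z; with one,
    only a difference of two labels would be known to lie in the derived
    algebra. *)
Lemma lab_derived v w Z : label G v w = Some Z -> label G w v = None ->
  lab R G Z \in derived N.
Proof.
move=> vw wv; have /derivedP/(_ (vtx R G v) (vtx R G w)) := subvv (derived N).
rewrite lie_vtx /basis_bracket (bigD1 Z) //= vw wv eqxx subr0 scale1r.
rewrite big1 ?addr0 // => Y YZ.
by rewrite (inj_eq Some_inj) eq_sym (negPf YZ) subr0 scale0r.
Qed.

Definition lab_part (x : N) : N := \sum_Z (x.2 Z : R) *: lab R G Z.

Lemma lab_decomp (x : N) : x - lab_part x \in vpart R G.
Proof.
rewrite memv_vpart -[(_ - _).2]/(x.2 - (lab_part x).2).
rewrite subr_eq0 linear_sum /=; apply/eqP/ffunP => Y.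
rewrite sum_ffunE (bigD1 Y) //= big1 ?addr0 => [|Z ZY].
  by rewrite !ffunE eqxx [RHS]mulr1.
by rewrite !ffunE eq_sym (negPf ZY) [LHS]mulr0.
Qed.

Lemma derived_vpart : (derived N :&: vpart R G = 0)%VS.
Proof.
apply/eqP; rewrite -subv0; apply/subvP => x; rewrite memv_cap memv_vpart memv0.
case/andP=> xD /eqP x2; suff x1 : x.1 = 0 by rewrite [x]surjective_pairing x1 x2.
have /subvP/(_ x xD) :
    (derived N <= lker (linfun (fst : N -> {ffun V -> R^o})))%VS.
  by apply/derivedP => y z; rewrite memv_ker lfunE; apply/eqP/graph_bracket1.
by rewrite memv_ker lfunE => /eqP.
Qed.

(** When the derived algebra contains all labels, splitting off the label part
    of a central vector leaves a central vector supported on the vertices, so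
    that the center intersected with the span of the vertices is an abelian
    factor. *)
Lemma nontrivial_abelian_factorP :
  (forall Z, lab R G Z \in derived N) ->
  has_nontrivial_abelian_factor R G <->
  exists x : N, [/\ x \in center N, x \in vpart R G & x != 0].
Proof.
move=> labD; split=> [[a [aV cE _] a0]|[x [xc xV x0]]].
  exists (vpick a); rewrite vpick0; split=> //; last exact: subvP aV _ (memv_pick a).
  by rewrite cE (subvP (addvSr _ _)) // memv_pick.
exists (center N :&: vpart R G)%VS; last first.
  by apply: contraNneq x0 => a0; rewrite -memv0 -a0 memv_cap xc.
split; first exact: capvSr.
- apply/eqP; rewrite eqEsubv subv_add capvSl andbT; apply/andP; split.
    apply/subvP => y yc.
    have -> : y = lab_part y + (y - lab_part y) by rewrite addrC subrK.
    apply: memv_add.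
      by apply: rpred_sum => Z _; apply: rpredZ; apply: labD.
    rewrite memv_cap lab_decomp andbT rpredB // rpred_sum // => Z _.
    by rewrite rpredZ // lab_center.
  apply/derivedP => y z; apply/centerP => t.
  by rewrite [LHS]graph_bracketC graph_bracket0r ?oppr0 ?graph_bracket1.
- apply/directv_addP/eqP; rewrite -subv0 -derived_vpart.
  by rewrite capvS // capvSr.
Qed.

End Graph.

(** * Rotation of the vertices of a cycle *)

Section Rotation.
Variable n : nat.

Lemma val_iter_ordS k (u : 'I_n) : iter k (@ordS n) u = (u + k) %% n :> nat.
Proof.
elim: k => [|k IH] /=; first by rewrite addn0 modn_small.
by rewrite IH addnS -addn1 modnDml addn1.
Qed.

Lemma ordS_ordS_neq (v : 'I_n) : 3 <= n -> ordS (ordS v) != v.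
Proof.
move=> n_ge3; apply/eqP => /(congr1 val).
rewrite [LHS](val_iter_ordS 2) => /eqP.
rewrite -[X in _ == X](modn_small (ltn_ord v)) -[X in _ == X %% _]addn0.
by rewrite eqn_modDl mod0n modn_small.
Qed.

Lemma ordS_transitive (u v : 'I_n) : exists k, v = iter k (@ordS n) u.
Proof.
exists (v + (n - u)); apply: val_inj; rewrite /= val_iter_ordS.
by rewrite addnCA subnKC 1?ltnW // modnDr modn_small.
Qed.

Lemma odd_ordS (u : 'I_n) : ~~ odd n -> odd (ordS u) = ~~ odd u.
Proof. by move=> n_even; rewrite /= odd_mod ?(negPf n_even). Qed.

End Rotation.

(** * Monochromatic runs *)

Section Cycle.
Variables (n : nat) (C : finType) (G : elgraph 'I_n C).
Hypothesis G_cycle : standard_cycle G.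

(** The label of the edge leaving i; it is kept as an option, so that no default
    label has to be chosen. *)
Definition color (i : 'I_n) : option C := label G i (ordS i).
Definition is_break (i : 'I_n) : bool := color (ord_pred i) != color i.
(** L counts edges, so that the run from b has L + 1 vertices. *)
Definition is_run (b : 'I_n) (L : nat) : Prop :=
  [/\ is_break b, forall i, i < L -> color (iter i (@ordS n) b) = color b
    & color (iter L (@ordS n) b) != color b].

Lemma label_cycle v w : label G v w = if w == ordS v then color v else None.
Proof.
case: eqP => [->//|/eqP/negPf nw].
by have := G_cycle v w; rewrite /edge /= nw; case: label.
Qed.

Lemma color_some v : exists Z, color v = Some Z.
Proof.
by have := G_cycle v (ordS v); rewrite /edge /color /= eqxx; case: label => // Z _; exists Z.
Qed.

Lemma label_adjE Z v w : label_adj G Z v w =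
  (w == ordS v) && (color v == Some Z) || (v == ordS w) && (color w == Some Z).
Proof. by rewrite /label_adj /= !label_cycle; do 2![case: ifP => _]. Qed.

Lemma label_adj_sym Z : symmetric (label_adj G Z).
Proof. by move=> v w; rewrite /label_adj /= orbC. Qed.

Lemma run_exists b : is_break b -> exists L, is_run b L.
Proof.
move=> bb; have exL : exists k, color (iter k (@ordS n) b) != color b.
  by have [k kE] := ordS_transitive b (ord_pred b); exists k; rewrite -kE.
case: (ex_minnP exL) => L cL Lmin; exists L; split=> // i iL.
by apply/eqP; apply: contraTT iL => /Lmin; rewrite -leqNgt.
Qed.

Lemma run_gt0 b L : is_run b L -> 0 < L.
Proof. by case: L => // -[_ _]; rewrite eqxx. Qed.

Lemma run_end_break b L : is_run b L -> is_break (iter L (@ordS n) b).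
Proof.
case: L => [/run_gt0//|L [_ cb cL]].
by rewrite /is_break iterS ordSK cb // eq_sym.
Qed.

(** A run cannot close up on itself: its last vertex is left by an edge with a
    label different from that of every edge of the run. *)
Lemma run_uniq b L : is_run b L -> uniq (traject (@ordS n) b L.+1).
Proof.
case=> _ cb cL; rewrite looping_uniq; apply: contra cL => /trajectP[i iL ->].
by rewrite cb.
Qed.

Lemma color_run b L i Z : is_run b L -> color b = Some Z -> i <= L ->
  (color (iter i (@ordS n) b) == Some Z) = (i < L).
Proof.
move=> [_ cb cL] bZ; rewrite leq_eqVlt => /predU1P[->|iL].
  by rewrite ltnn -bZ; apply: negPf.
by rewrite cb // bZ eqxx iL.
Qed.

(** The vertices of a run are linked by its edges; conversely no other edge with
    the same label touches them, because both ends of the run are breaks. *)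
Lemma run_component b L Z w : is_run b L -> color b = Some Z ->
  connect (label_adj G Z) b w = (w \in traject (@ordS n) b L.+1).
Proof.
move=> run bZ; apply/idP/idP => [bw|/trajectP[i iL ->]].
  have cl : closed (label_adj G Z) (mem (traject (@ordS n) b L.+1)).
    apply: intro_closed => [|u v]; first exact/sym_connect_sym/label_adj_sym.
    rewrite label_adjE => uv /trajectP[i iL uE]; apply/trajectP; move: uv.
    case/orP=> /andP[/eqP E cZ]; first last.
      (* [v] precedes [u]: this can only happen after the initial break. *)
      case: i => [|i] in iL uE *; last first.
        by exists i; [exact: ltnW | apply: (@ordS_inj n); rewrite -E uE].
      case: run => bb _ _; move: bb.
      by rewrite /is_break -[b]uE E ordSK (eqP cZ) -E uE /= bZ eqxx.
    (* [v] follows [u]: the edge belongs to the run, so [u] is not its end. *)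
    exists i.+1; last by rewrite iterS -uE.
    by rewrite ltnS -(color_run run bZ) // -uE.
  have := closed_connect cl bw => /= <-.
  exact: mem_head.
elim: i iL => [|i IH] iL; first exact: connect0.
apply: connect_trans (IH (ltnW iL)) (connect1 _).
have iL1 : i < L by [].
by rewrite label_adjE iterS eqxx (color_run run bZ (ltnW iL1)) iL1.
Qed.

(** The labelled edges between vertices of a run are the L edges of the run: an
    edge closing it up would leave its last vertex, hence have another label. *)
Lemma run_path b L Z : is_run b L -> color b = Some Z ->
  is_path_graph (label_adj G Z) [set w | connect (label_adj G Z) b w]
    (traject (@ordS n) b L.+1).
Proof.
move=> run bZ; have uniq_t := run_uniq run.
split=> // [w|v w]; rewrite inE (run_component _ run bZ) //.
rewrite inE (run_component _ run bZ).
have idx i : i <= L -> index (iter i (@ordS n) b) (traject (@ordS n) b L.+1) = i.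
  move=> iL.
  by rewrite -(nth_traject (@ordS n) (n := L.+1)) ?index_uniq ?size_traject.
have step i j : i <= L -> j <= L ->
    (iter j (@ordS n) b == ordS (iter i (@ordS n) b)) &&
    (color (iter i (@ordS n) b) == Some Z) = (j == i.+1).
  move=> iL jL; rewrite (color_run run bZ iL).
  case: (ltnP i L) => iL'; last first.
    by rewrite andbF; apply/esym/negbTE; rewrite neq_ltn ltnS (leq_trans jL iL').
  rewrite andbT -iterS; apply/eqP/eqP => [|->//] E.
  by rewrite -(idx j) // E idx.
move=> /trajectP[i iL ->] /trajectP[j jL ->].
by rewrite label_adjE !step // !idx.
Qed.

(** Walking back from [iter m ordS u] while the label does not change stops at a
    break, at the latest just after u. *)
Lemma break_before m u : color u != color (iter m (@ordS n) u) ->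
  exists b k, [/\ is_break b, iter m (@ordS n) u = iter k (@ordS n) b
    & forall i, i <= k -> color (iter i (@ordS n) b) = color b].
Proof.
elim: m => [|m IH] cu; first by rewrite eqxx in cu.
have [cE|cN] :=
    eqVneq (color (iter m (@ordS n) u)) (color (iter m.+1 (@ordS n) u)).
  have [|b [k [bb kE ck]]] := IH; first by rewrite cE.
  exists b, k.+1; split=> [//||i]; first by rewrite !iterS kE.
  rewrite leq_eqVlt => /predU1P[->|/ck//].
  by rewrite iterS -kE -iterS -cE kE ck.
exists (iter m.+1 (@ordS n) u), 0; split=> [|//|i].
  by rewrite /is_break iterS ordSK.
by rewrite leqn0 => /eqP ->.
Qed.

Hypothesis C_ge2 : 2 <= #|C|.

Lemma other_color Z : exists u, color u != Some Z.
Proof.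
have /existsP[Y YZ] : [exists Y, Y != Z].
  rewrite -negb_forall; apply/negP => /forallP allZ.
  have /subset_leq_card : [set: C] \subset [set Z].
    by apply/subsetP => Y _; rewrite inE; apply/eqP/eqP/allZ.
  by rewrite cardsT cards1 leqNgt C_ge2.
have [v [w]] := label_surj G Y; rewrite label_cycle; case: eqP => // _ cv.
by exists v; rewrite cv (inj_eq Some_inj).
Qed.

(** Every edge lies on a run, since a cycle with at least two labels is not
    monochromatic. *)
Lemma run_through v : exists b L, [/\ is_run b L, color b = color v,
  v \in traject (@ordS n) b L.+1 & ordS v \in traject (@ordS n) b L.+1].
Proof.
have [Z vZ] := color_some v; have [u uZ] := other_color Z.
have [m vE] := ordS_transitive u v.
have [|b [k [bb kE ck]]] := @break_before m u; first by rewrite -vE vZ.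
have [L run] := run_exists bb; exists b, L.
have kL : k < L.
  by rewrite ltnNge; apply/negP => /ck cL; case: run => _ _; rewrite cL eqxx.
rewrite vE kE; split=> //; first by rewrite ck.
  by apply/trajectP; exists k => //; apply: ltnW.
by apply/trajectP; exists k.+1.
Qed.

Lemma break_exists : exists b, is_break b.
Proof.
have /card_gt0P[Z _] : 0 < #|C| by apply: ltnW.
have [u _] := other_color Z; have [b [L [[bb _ _] _ _ _]]] := run_through u.
by exists b.
Qed.

(** Runs and components correspond to each other.  A path enumerating a
    component has as many vertices as the run, so the parity of its number of
    edges does not depend on the enumeration. *)
Lemma even_path_unionP :
  (forall Z, even_path_union G Z) <-> (forall b L, is_run b L -> ~~ odd L).
Proof.
split=> [evG b L run | evR Z W].
  have [Z bZ] := color_some b.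
  have [|s [us Ws _]] := evG Z [set w | connect (label_adj G Z) b w].
    apply/imsetP; exists b => //; rewrite inE; apply/existsP; exists (ordS b).
    by rewrite label_adjE eqxx bZ eqxx.
  suff -> : size s = L.+1 by [].
  rewrite -(size_traject (@ordS n) b L.+1); apply/perm_size/uniq_perm => //.
    exact: run_uniq.
  by move=> w; rewrite -Ws inE (run_component _ run bZ).
case/imsetP=> v; rewrite inE => /existsP[w]; rewrite label_adjE => vw WE.
have [b [L [run bZ bv]]] : exists b L, [/\ is_run b L, color b = Some Z
    & v \in traject (@ordS n) b L.+1].
  case/orP: vw => /andP[/eqP E /eqP cZ].
    by have [b [L [run]]] := run_through v; rewrite cZ; exists b, L.
  by have [b [L [run]]] := run_through w; rewrite cZ -E; exists b, L.
exists (traject (@ordS n) b L.+1); last by rewrite size_traject; apply: evR run.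
suff -> : W = [set w | connect (label_adj G Z) b w] by exact: run_path.
rewrite WE; apply/setP => t; rewrite !inE.
apply/esym/same_connect; last by rewrite (run_component _ run bZ).
exact/sym_connect_sym/label_adj_sym.
Qed.

(** Two breaks are separated by a sequence of consecutive runs, which induction
    on the distance removes one at a time. *)
Lemma break_dist_even : (forall b L, is_run b L -> ~~ odd L) ->
  forall k b, is_break b -> is_break (iter k (@ordS n) b) -> ~~ odd k.
Proof.
move=> evR; elim/ltn_ind=> -[//|k] IH b bb bk.
have [L run] := run_exists bb.
have [Lk|kL] := leqP L k.+1.
  rewrite -(subnK Lk) oddD (negPf (evR _ _ run)) addbF.
  apply: (IH _ _ _ (run_end_break run)); last by rewrite -iterD subnK.
  by rewrite ltn_subrL (run_gt0 run).
case: run => _ ck _; move: bk.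
by rewrite /is_break iterS ordSK -iterS !ck ?eqxx // ltnW.
Qed.

(** A break is at distance n from itself, hence n is even; reduction modulo n
    then preserves parities. *)
Lemma break_parity : (forall b L, is_run b L -> ~~ odd L) ->
  ~~ odd n /\ forall b b', is_break b -> is_break b' -> odd b = odd b'.
Proof.
move=> evR; have D := break_dist_even evR.
have n_even : ~~ odd n.
  have [b bb] := break_exists; apply: (D n b) => //.
  suff -> : iter n (@ordS n) b = b by [].
  by apply: val_inj; rewrite /= val_iter_ordS modnDr modn_small.
split=> // b b' bb; have [k ->] := ordS_transitive b b' => bk.
by rewrite val_iter_ordS odd_mod ?(negPf n_even) // oddD (negPf (D _ _ bb bk)) addbF.
Qed.

End Cycle.

(** * Central vectors supported on the vertices *)

Section CycleLie.
Import GRing.Theory.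
Local Open Scope ring_scope.
Variables (R : fieldType) (n : nat) (C : finType) (G : elgraph 'I_n C).
Hypothesis G_cycle : standard_cycle G.
Local Notation N := (graph_lie R G).

(** Collecting the bracket by the coordinates of its second argument: only the
    two neighbours of w contribute to the coefficient of y(w). *)
Lemma lie_cycleE (x y : N) Z : (lie x y).2 Z = \sum_w y.1 w *
  ((color G (ord_pred w) == Some Z)%:R * x.1 (ord_pred w)
   - (color G w == Some Z)%:R * x.1 (ordS w)).
Proof.
rewrite -[lie x y]/(graph_bracket x y) /graph_bracket exchange_big linear_sum sum_ffunE.
apply: eq_bigr => w _ /=; rewrite linear_sum sum_ffunE.
have bbE v : (basis_bracket R G v w).2 Z =
    (label G v w == Some Z)%:R - (label G w v == Some Z)%:R.
  rewrite /basis_bracket linear_sum sum_ffunE (bigD1 Z) //= big1 ?addr0 => [|Y YZ].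
    by rewrite !ffunE eqxx [LHS]mulr1.
  by rewrite !ffunE [Z == _]eq_sym (negPf YZ) [LHS]mulr0.
rewrite (eq_bigr (fun v => y.1 w * ((label G v w == Some Z)%:R * x.1 v)
    - y.1 w * ((label G w v == Some Z)%:R * x.1 v))); last first.
  move=> v _; rewrite ffunE bbE.
  by rewrite -mulrBr -mulrBl -[LHS]/(_ * _) [RHS]mulrA [RHS]mulrC mulrA.
rewrite sumrB -!mulr_sumr -mulrBr; congr (_ * (_ - _)).
  rewrite (bigD1 (ord_pred w)) //= label_cycle // ord_predK eqxx big1 ?addr0 // => v vw.
  rewrite label_cycle //; case: (w =P ordS v) => [E|]; last by rewrite mul0r.
  by rewrite E ordSK eqxx in vw.
rewrite (bigD1 (ordS w)) //= label_cycle // eqxx big1 ?addr0 // => v vw.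
by rewrite label_cycle // (negPf vw) mul0r.
Qed.

(** Comparing the coefficients of the labels of the two edges at w gives
    x(w-1) = x(w+1) if the labels agree, and x(w-1) = x(w+1) = 0 otherwise; in
    both cases x is invariant under translation by two. *)
Lemma center_cycleP (x : N) : x \in center N <->
  (forall w, x.1 (ord_pred w) = x.1 (ordS w)) /\
  (forall w, is_break G w -> x.1 (ordS w) = 0).
Proof.
set coef := fun w Z => (color G (ord_pred w) == Some Z)%:R * x.1 (ord_pred w)
   - (color G w == Some Z)%:R * x.1 (ordS w).
have -> : x \in center N <-> forall w Z, coef w Z = 0.
  split=> [/centerP xc w Z | coef0].
    have /(congr1 (fun z : N => z.2 Z)) := xc (vtx R G w).
    rewrite lie_cycleE (bigD1 w) //= big1 => [|v vw].
      by rewrite !ffunE eqxx mul1r addr0.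
    by rewrite ffunE (negPf vw) mul0r.
  apply/centerP => y; rewrite [lie x y]surjective_pairing [_.1]graph_bracket1.
  congr (_, _); apply/ffunP => Z; rewrite lie_cycleE ffunE big1 // => w _.
  by rewrite [X in _ * X]coef0 mulr0.
split=> [coef0|[xE xb] w Z].
  have xb w : is_break G w -> x.1 (ord_pred w) = 0 /\ x.1 (ordS w) = 0.
    move=> bw; have [Y wY] := color_some G_cycle w.
    have [Y' wY'] := color_some G_cycle (ord_pred w).
    move: bw (coef0 w Y) (coef0 w Y'); rewrite /is_break /coef wY wY' !eqxx => bw.
    rewrite (negPf bw) eq_sym (negPf bw) !mul0r !mul1r sub0r subr0.
    by move=> /eqP; rewrite oppr_eq0 => /eqP.
  split=> [w|w /xb[]//]; have [/xb[-> ->]//|] := boolP (is_break G w).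
  rewrite negbK => /eqP cE; have [Y wY] := color_some G_cycle w.
  by have /eqP := coef0 w Y; rewrite /coef cE wY eqxx !mul1r subr_eq0 => /eqP.
rewrite /coef xE -mulrBl; have [/xb->|] := boolP (is_break G w); first by rewrite mulr0.
by rewrite negbK => /eqP->; rewrite subrr mul0r.
Qed.

(** A central x is determined by its values at b and b + 1.  If a run from b has
    odd length L, then x vanishes at b + 1 and at b + L + 1, which is an even
    number of steps away from b; so x = 0.  If all runs are even, all breaks share a parity, and
    the indicator function of that parity vanishes next to every break. *)
Lemma center_vpart_evenP : (2 <= #|C|)%N ->
  (exists x : N, [/\ x \in center N, x \in vpart R G & x != 0]) <->
  (forall b L, is_run G b L -> ~~ odd L).
Proof.
move=> C_ge2; split=> [[x [/center_cycleP[xE xb] xV x0]] b L run | evR].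
  have shift k u : x.1 (iter k (@ordS n) u) = x.1 (iter (odd k) (@ordS n) u).
    elim/ltn_ind: k u => -[|[|k]] IH u //.
    by rewrite !iterS -xE ordSK IH //= negbK.
  apply: contraNN x0 => oddL; case: (run) => bb _ _.
  have xb1 := xb _ bb.
  have xb0 : x.1 b = 0.
    by have := xb _ (run_end_break run); rewrite -iterS shift /= oddL.
  move: xV; rewrite memv_vpart => /eqP x2.
  rewrite [x]surjective_pairing x2; apply/eqP; congr (_, _); apply/ffunP => u.
  by have [k ->] := ordS_transitive b u; rewrite shift ffunE; case: odd.
have [n_even par] := break_parity G_cycle C_ge2 evR.
have [b bb] := break_exists G_cycle C_ge2.
exists ([ffun u : 'I_n => (odd u == odd b)%:R], 0); split.
- apply/center_cycleP; split=> /= w.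
    rewrite !ffunE odd_ordS //; congr (_ == _)%:R.
    by rewrite -{2}[w]ord_predK odd_ordS // negbK.
  by move=> bw; rewrite ffunE odd_ordS // (par _ _ bw bb); case: odd.
- by rewrite memv_vpart.
apply/eqP => -[/ffunP/(_ b)]; rewrite !ffunE eqxx => /eqP.
by rewrite oner_eq0.
Qed.

(** On two vertices the two edges would be antiparallel, and the brackets would
    only give the difference of their labels. *)
Lemma cycle_lab_derived Z : (3 <= n)%N -> lab R G Z \in derived N.
Proof.
move=> n_ge3; have [v [w vw]] := label_surj G Z; apply: (lab_derived R vw).
move: vw; rewrite !label_cycle //; case: eqP => // -> _; case: eqP => // E.
by have := ordS_ordS_neq v n_ge3; rewrite -E eqxx.
Qed.

End CycleLie.

Theorem proposition4p7 (R : realType) (n : nat) (C : finType)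
    (G : elgraph 'I_n C) (n_ge3 : (3 <= n)%N)
    (G_cycle : standard_cycle G) (C_ge2 : (2 <= #|C|)%N) :
  has_nontrivial_abelian_factor R G <-> forall Z : C, even_path_union G Z.
Proof.
rewrite nontrivial_abelian_factorP; last by move=> Z; exact: cycle_lab_derived.
by rewrite center_vpart_evenP // even_path_unionP.
Qed.
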